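(* Let $d\ge1$. The ideal $\mathcal I$ is generated by the elements $\widetilde q_\Theta$, where $\Theta$ runs over the unimodular $d\times d$-submatrices of $\bigl(X_d^{(1)}\,|\,X_d^{(2)}\bigr)$.
   Context: $\Pi^d$ denotes the ring of polynomials in the variables $\boldsymbol z=(z_1,\dots,z_d)$ (real coefficients), and $\mathcal I=\{p\in\Pi^d:\ p(\varepsilon)=0\text{ for all }\varepsilon\in\{-1,+1\}^d\setminus\{(1,\dots,1)\}\}$, an ideal of $\Pi^d$. $X_d^{(1)}=I_d$ is the matrix whose columns are the standard unit vectors $e_1,\dots,e_d$, and $X_d^{(2)}$ is the matrix whose columns are the vectors $e_j+e_k$, $j\neq k$ (one column for each unordered pair). A $d\times d$-submatrix is obtained by selecting $d$ distinct columns; it is unimodular if $\det\Theta=\pm1$. For such $\Theta$, $\widetilde q_\Theta(\boldsymbol z)=\prod_{\theta\in\Theta}\widetilde r_\theta(\boldsymbol z)$, where $\theta$ runs through the columns of $\Theta$ and $\widetilde r_\theta(\boldsymbol z)=\frac{1+z_k}{2}$ if $\theta=e_k$, $\widetilde r_\theta(\boldsymbol z)=\frac{z_j+z_k}{2}$ if $\theta=e_j+e_k$. *)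

(* Defs.v *)
From HB Require Import structures.
From mathcomp Require Import all_boot all_order all_algebra.
From mathcomp Require Import reals.
From mathcomp Require Import mpoly.

Set Implicit Arguments.
Unset Strict Implicit.
Unset Printing Implicit Defensive.

Import GRing.Theory.
Local Open Scope ring_scope.

Definition ideal_generated (A : comNzRingType) (G : A -> Prop) (p : A) : Prop :=
  exists (n : nat) (a g : 'I_n -> A),
    (forall i, G (g i)) /\ p = \sum_(i < n) a i * g i.

Definition cube_ideal (R : realType) (d : nat) (p : {mpoly R[d]}) : Prop :=
  forall eps : 'I_d -> R,
    (forall i, eps i = -1 \/ eps i = 1) ->
    ~ (forall i, eps i = 1) ->
    p.@[eps] = 0.

(* Unordered pairs of distinct indices, represented by j < k. *)
Definition upair (d : nat) : finType :=
  {jk : 'I_d * 'I_d | (jk.1 < jk.2)%N}.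

Definition evec (d : nat) (k : 'I_d) : 'cV[int]_d := delta_mx k 0.

Definition X1 (d : nat) : 'M[int]_d := \matrix_(i, k) evec k i 0.

Definition X2 (d : nat) : 'M[int]_(d, #|upair d|) :=
  \matrix_(i, c) let: (j, k) := val (enum_val c) in (evec j + evec k) i 0.

Definition X12 (d : nat) : 'M[int]_(d, d + #|upair d|) :=
  row_mx (X1 d) (X2 d).

(* A d x d submatrix is given by the injective family [t] of the indices of its
   columns. The order in which the columns are listed affects neither
   [unimodular t] nor [q_tilde R t]. *)
Definition unimodular (d : nat) (t : 'I_d -> 'I_(d + #|upair d|)) : Prop :=
  injective t /\ (\det (colsub t (X12 d)) = 1 \/ \det (colsub t (X12 d)) = -1).

(* [split c] tells whether column [c] of [X12 d] lies in [X1 d] or in [X2 d]. *)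
Definition r_tilde (R : realType) (d : nat) (c : 'I_(d + #|upair d|)) :
    {mpoly R[d]} :=
  match split c with
  | inl k => 2^-1 *: (1 + 'X_k)
  | inr c' => let: (j, k) := val (enum_val c') in 2^-1 *: ('X_j + 'X_k)
  end.

Definition q_tilde (R : realType) (d : nat) (t : 'I_d -> 'I_(d + #|upair d|)) :
    {mpoly R[d]} :=
  \prod_(i < d) r_tilde R (t i).

(* Main.v *)
Require Import Defs.
From mathcomp Require Import all_boot all_order all_algebra.
From mathcomp Require Import reals.
From mathcomp Require Import mpoly.
From mathcomp Require Import ring zify.

(** The proof reads the columns of [X12 d] as the edges of the complete graph on
    the vertices 0, 1, ..., d, where the extra vertex 0 has coordinate z_0 = 1:
    the column e_k is the edge {0, k}, the column e_j + e_k the edge {j, k}, and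
    up to the factor 1/2 the polynomial of an edge is the sum of the coordinates
    of its ends. Every spanning tree is a unimodular submatrix, because
    e_v = (column of the edge from v to its parent) - e_(parent of v) expresses
    all unit vectors through the columns, starting at the root 0
    ([tree_on_unimodular]). Hence it is enough to show that unimodular products
    vanish on the punctured cube, that is the sign vectors other than (1, ..., 1),
    and that the tree products generate.

    Vanishing ([q_tilde_cube_ideal]): let eps be a sign vector at which no factor
    of the product vanishes, and s the indicator of its entries -1. Every column
    e_k has eps_k = 1 and every column e_j + e_k has eps_j = eps_k, so all entries
    of s * Theta are even. Multiplying by the adjugate of Theta, whose determinant
    is 1 or -1, shows that s itself is even; so s = 0 and eps = (1, ..., 1).

    Generation ([cube_ideal_sub_tree_ideal]): write 1 as the sum of the Lagrange
    polynomials L_eps = prod_i (1 + eps_i z_i)/2 over all sign vectors. Modulo the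
    ideal generated by the z_i^2 - 1 one has p L_eps = p(eps) L_eps, so a
    polynomial p that vanishes on the punctured cube is congruent to p(1) L_1, and
    L_1 is, up to a scalar, the product of the star centred at 0. It remains to
    show that every z_u^2 - 1 lies in the ideal of tree products. This is
    [tree_ideal_sqr_sub1], an induction on the vertex set in which trees are
    extended by leaves. *)

Set Implicit Arguments.
Unset Strict Implicit.
Unset Printing Implicit Defensive.

Import GRing.Theory Num.Theory.
Local Open Scope ring_scope.

(** * Generated ideals *)

Lemma ideal_generated_gen (A : comNzRingType) (G : A -> Prop) g :
  G g -> ideal_generated G g.
Proof.
move=> Gg; exists 1%N, (fun=> 1), (fun=> g); split=> //.
by rewrite big_ord1 mul1r.
Qed.

Lemma ideal_generated0 (A : comNzRingType) (G : A -> Prop) :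
  ideal_generated G 0.
Proof.
exists 0%N, (fun=> 0), (fun=> 0); split; first by case.
by rewrite big_ord0.
Qed.

Lemma ideal_generatedD (A : comNzRingType) (G : A -> Prop) p q :
  ideal_generated G p -> ideal_generated G q -> ideal_generated G (p + q).
Proof.
move=> [m [a [g [Gg ->]]]] [n [b [h [Gh ->]]]].
pose glue (s t : _ -> A) (i : 'I_(m + n)) :=
  match split i with inl j => s j | inr j => t j end.
exists (m + n)%N, (glue a b), (glue g h); split=> [i|].
  by rewrite /glue; case: (split i).
have splitl j : split (lshift n j) = inl j := unsplitK (inl j).
have splitr j : split (rshift m j) = inr j := unsplitK (inr j).
rewrite big_split_ord /glue /=.
by congr (_ + _); apply: eq_bigr => i _; rewrite ?splitl ?splitr.
Qed.

Lemma ideal_generatedM (A : comNzRingType) (G : A -> Prop) c p :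
  ideal_generated G p -> ideal_generated G (c * p).
Proof.
move=> [n [a [g [Gg ->]]]]; exists n, (fun i => c * a i), g; split=> //.
by rewrite mulr_sumr; apply: eq_bigr => i _; rewrite mulrA.
Qed.

Lemma ideal_generatedB (A : comNzRingType) (G : A -> Prop) p q :
  ideal_generated G p -> ideal_generated G q -> ideal_generated G (p - q).
Proof.
move=> Ip Iq; apply: ideal_generatedD => //.
by rewrite -mulN1r; apply: ideal_generatedM.
Qed.

Lemma ideal_generated_sum (A : comNzRingType) (G : A -> Prop) (I : Type)
    (s : seq I) (P : pred I) (F : I -> A) :
  (forall i, P i -> ideal_generated G (F i)) ->
  ideal_generated G (\sum_(i <- s | P i) F i).
Proof.
move=> IF; apply: big_ind => //; first exact: ideal_generated0.
exact: ideal_generatedD.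
Qed.

(** With [c := 1] this compares two generated ideals; a general [c] is what the
    attachment of a leaf to all trees at once requires. *)
Lemma ideal_generated_mulr_sub (A : comNzRingType) (G H : A -> Prop) c p :
  (forall g, G g -> ideal_generated H (g * c)) ->
  ideal_generated G p -> ideal_generated H (p * c).
Proof.
move=> GH [n [a [g [Gg ->]]]]; rewrite mulr_suml.
apply: ideal_generated_sum => i _; rewrite -mulrA.
exact/ideal_generatedM/GH.
Qed.

(** * Ideals of tree products *)

(** The vertex 0 of the graph is [None]; its coordinate is 1. *)
Definition vertex_coord (R : numFieldType) (d : nat) (o : option 'I_d) :
    {mpoly R[d]} :=
  if o is Some w then 'X_w else 1.

(** A tree on the vertices [S] and the root [None], given by its parent function.
    A height that decreases towards the root excludes cycles, and unlike an
    inductive definition it does not fix an order in which the leaves are added. *)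
Definition tree_on (d : nat) (S : {set 'I_d}) (f : 'I_d -> option 'I_d) : Prop :=
  exists h : 'I_d -> nat, forall v, v \in S ->
    if f v is Some w then (w \in S) && (h w < h v)%N else true.

Definition tree_poly (R : numFieldType) (d : nat) (S : {set 'I_d})
    (f : 'I_d -> option 'I_d) : {mpoly R[d]} :=
  \prod_(v in S) ('X_v + vertex_coord R (f v)).

Definition tree_ideal (R : numFieldType) (d : nat) (S : {set 'I_d}) :
    {mpoly R[d]} -> Prop :=
  ideal_generated (fun q => exists f, tree_on S f /\ q = tree_poly R S f).

(** Attaching [v] as a leaf to the vertex [o] turns all trees on [S] into trees on
    [v |: S] and multiplies their products by the same factor. *)
Lemma tree_ideal_leaf (R : numFieldType) (d : nat) (S : {set 'I_d}) v o
    (p : {mpoly R[d]}) :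
  v \notin S -> (if o is Some w then w \in S else true) ->
  tree_ideal S p -> tree_ideal (v |: S) (p * ('X_v + vertex_coord R o)).
Proof.
move=> vS oS; apply: ideal_generated_mulr_sub => _ [f [[h hP] ->]].
apply: ideal_generated_gen.
pose f' x := if x == v then o else f x.
pose h' x := if x == v then (\sum_y h y).+1 else h x.
exists f'; split.
  (* The new leaf is higher than every vertex that is present. *)
  exists h' => x; rewrite !inE /f' /h'; case: eqP => [-> _|_ /= xS].
    move: oS; case: (o) => //= w wS; rewrite !inE wS orbT /=.
    have /negPf->: w != v by apply: contraNneq vS => <-.
    by rewrite ltnS (bigD1 w) //= leq_addr.
  have := hP x xS; case: (f x) => // w /andP[wS hw].
  rewrite inE wS orbT /=.
  by have /negPf->: w != v by apply: contraNneq vS => <-.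
rewrite /tree_poly big_setU1 //= mulrC {1}/f' eqxx; congr (_ * _).
apply: eq_bigr => x xS; rewrite /f'.
by have /negPf->: x != v by apply: contraNneq vS => <-.
Qed.

Lemma tree_ideal0 (R : numFieldType) (d : nat) :
  tree_ideal (set0 : {set 'I_d}) (1 : {mpoly R[d]}).
Proof.
apply: ideal_generated_gen; exists (fun=> None); split.
  by exists (fun=> 0%N) => v.
by rewrite /tree_poly big_set0.
Qed.

(** Induction on the size of [S]. On one vertex, z_u + 1 is itself a tree product.
    On two vertices, the path 0 - u - v minus its variant where v hangs from 0
    cancels z_v and leaves (z_u + 1)(z_u - 1). On three or more vertices, let v
    and w be two vertices other than u, and q = z_u^2 - 1, which lies in the
    ideals of S \ v and of S \ w by induction. Attaching v to w and to 0 gives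
    q (z_v + z_w) and q (z_v + 1), hence q (z_w - 1). Attaching w to 0 gives
    q (z_w + 1). The difference is 2 q. *)
Lemma tree_ideal_sqr_sub1 (R : numFieldType) (d : nat) (S : {set 'I_d}) u :
  u \in S -> tree_ideal S ('X_u ^+ 2 - 1 : {mpoly R[d]}).
Proof.
have [n] := ubnP #|S|; elim: n S => // n IHn S; rewrite ltnS => cardS uS.
have Iu : tree_ideal [set u] ('X_u + 1 : {mpoly R[d]}).
  have := tree_ideal_leaf (v := u) (o := None) _ _ (tree_ideal0 R d).
  by rewrite setU0 mul1r; apply; rewrite ?inE.
have [S1|[v]] := set_0Vmem (S :\ u).
  have ->: S = [set u] by rewrite -(setD1K uS) S1 setU0.
  have ->: 'X_u ^+ 2 - 1 = ('X_u - 1) * ('X_u + 1) :> {mpoly R[d]} by ring.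
  exact: ideal_generatedM.
rewrite !inE => /andP[vu vS].
have [S2|[w]] := set_0Vmem (S :\ v :\ u).
  have SE : S = v |: [set u].
    rewrite -(setD1K vS); congr (_ |: _).
    by rewrite -(@setD1K _ u (S :\ v)) ?S2 ?setU0 // !inE eq_sym vu.
  have vNu : v \notin [set u] by rewrite inE.
  have Iuv o : (if o is Some w then w \in [set u] else true) ->
    tree_ideal S (('X_u + 1) * ('X_v + vertex_coord R o)).
    by move=> oS; rewrite SE; apply: tree_ideal_leaf.
  have := ideal_generatedB (Iuv (Some u) (set11 u)) (Iuv None isT).
  by congr ideal_generated; rewrite /=; ring.
rewrite !inE => /and3P[wu wv wS].
have grow x o : x \in S -> x != u ->
    (if o is Some w then w \in S :\ x else true) ->
    tree_ideal S (('X_u ^+ 2 - 1) * ('X_x + vertex_coord R o)).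
  move=> xS xu oS; rewrite -{1}(setD1K xS).
  apply: tree_ideal_leaf => //; first by rewrite !inE eqxx.
  apply: IHn; last by rewrite !inE eq_sym xu.
  by rewrite (cardsD1 x) xS in cardS.
have wSv : w \in S :\ v by rewrite !inE wv.
have Iw1 := ideal_generatedB (grow v (Some w) vS vu wSv) (grow v None vS vu isT).
have I2 := ideal_generatedB (grow w None wS wu isT) Iw1.
have := ideal_generatedM (2^-1)%:MP I2.
congr ideal_generated => /=.
transitivity ((2^-1 : R)%:MP * 2%:MP * ('X_u ^+ 2 - 1) : {mpoly R[d]}).
  by rewrite [2%:MP]mpolyC_nat; ring.
by rewrite -mpolyCM mulVf ?pnatr_eq0 // mpolyC1 mul1r.
Qed.

(** * Interpolation on the cube *)

(** Modulo the ideal, if each variable acts on [L] as the scalar [eps i], then every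
    polynomial acts on [L] as its value at [eps]: the polynomials with this
    property form a subalgebra that contains the variables. *)
Lemma ideal_generated_sub_eval (R : comNzRingType) (d : nat)
    (G : {mpoly R[d]} -> Prop) (eps : 'I_d -> R) (L p : {mpoly R[d]}) :
  (forall i, ideal_generated G (('X_i - (eps i)%:MP) * L)) ->
  ideal_generated G ((p - p.@[eps]%:MP) * L).
Proof.
move=> IX; pose Q q := ideal_generated G ((q - q.@[eps]%:MP) * L).
have QC c : Q c%:MP.
  by rewrite /Q mevalC subrr mul0r; apply: ideal_generated0.
have QD q r : Q q -> Q r -> Q (q + r).
  rewrite /Q mevalD mpolyCD => Iq Ir.
  by have := ideal_generatedD Iq Ir; congr ideal_generated; ring.
have QM q r : Q q -> Q r -> Q (q * r).
  rewrite /Q mevalM mpolyCM => Iq Ir.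
  have := ideal_generatedD (ideal_generatedM r Iq)
            (ideal_generatedM (q.@[eps])%:MP Ir).
  by congr ideal_generated; ring.
have QX m : Q 'X_[m].
  rewrite mpolyXE_id; apply: big_ind => //; first by rewrite -mpolyC1.
  move=> i _; elim: (m i) => [|k IHk]; first by rewrite expr0 -mpolyC1.
  by rewrite exprS; apply: QM => //; rewrite /Q mevalXU.
rewrite -/(Q p) [p]mpolyE; apply: big_ind => //.
  by rewrite -mpolyC0.
by move=> m _; rewrite -mul_mpolyC; apply: QM.
Qed.

Lemma cube_ideal_sub_tree_ideal (R : realType) (d : nat) (p : {mpoly R[d]}) :
  cube_ideal p -> tree_ideal setT p.
Proof.
move=> p0.
pose D (i : 'I_d) b : {mpoly R[d]} :=
  (2^-1)%:MP * (if b then 1 + 'X_i else 1 - 'X_i).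
(* The Lagrange polynomial of the sign vector that is 1 exactly on J. *)
pose L (J : {set 'I_d}) := \prod_i (if i \in J then D i true else D i false).
have half2 : (2^-1)%:MP * 2%:MP = 1 :> {mpoly R[d]}.
  by rewrite -mpolyCM mulVf ?pnatr_eq0 // mpolyC1.
have L1 : \sum_J L J = 1.
  rewrite /L -bigA_distr /=; apply: big1 => i _.
  by apply: etrans half2; rewrite /D [2%:MP]mpolyC_nat; ring.
rewrite -[p]mulr1 -L1 mulr_sumr; apply: ideal_generated_sum => J _.
pose eps i : R := if i \in J then 1 else -1.
have : tree_ideal setT ((p - p.@[eps]%:MP) * L J).
  apply: ideal_generated_sub_eval => i.
  (* (z_i - eps_i)(1 + eps_i z_i)/2 = eps_i (z_i^2 - 1)/2. *)
  rewrite /L (bigD1 i) //= mulrA.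
  have := ideal_generatedM
    ((2^-1)%:MP * (-1) ^+ (i \notin J)
       * \prod_(j | j != i) (if j \in J then D j true else D j false))
    (tree_ideal_sqr_sub1 R (in_setT i)).
  congr ideal_generated; rewrite /eps /D; case: (i \in J) => /=.
    by rewrite mpolyC1; ring.
  by rewrite mpolyCN mpolyC1; ring.
suff: tree_ideal setT (p.@[eps]%:MP * L J).
  by move=> I1 I2; have := ideal_generatedD I1 I2; congr ideal_generated; ring.
have [JT|/eqP JT] := eqVneq J setT; last first.
  rewrite p0; first by rewrite mpolyC0 mul0r; apply: ideal_generated0.
    by move=> i; rewrite /eps; case: ifP; [right|left].
  move=> eps1; apply: JT; apply/setP=> i; rewrite inE.
  have := eps1 i; rewrite /eps; case: ifP => // _ /eqP.
  by rewrite eq_sym -subr_eq0 opprK -mulr2n pnatr_eq0.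
apply: ideal_generatedM; rewrite {}JT /L.
have ->: \prod_i (if i \in [set: 'I_d] then D i true else D i false)
       = (\prod_(i < d) (2^-1)%:MP) * tree_poly R setT (fun=> None).
  rewrite /tree_poly (big_mkcond (mem setT)) -big_split /=.
  by apply: eq_bigr => i _; rewrite !inE /D addrC.
apply: ideal_generatedM; apply: ideal_generated_gen.
by exists (fun=> None); split=> //; exists (fun=> 0%N).
Qed.

(** * Trees and unimodular submatrices *)

Lemma evecE (d : nat) (i k : 'I_d) : evec k i 0 = (i == k)%:R.
Proof. by rewrite mxE eqxx andbT. Qed.

Lemma edge_column (R : realType) (d : nat) (v : 'I_d) (o : option 'I_d) :
  o != Some v ->
  exists c : 'I_(d + #|upair d|),
    r_tilde R c = 2^-1 *: ('X_v + vertex_coord R o) /\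
    col c (X12 d) = evec v + oapp (@evec d) 0 o.
Proof.
case: o => [w|] wv; last first.
  exists (lshift _ v); split.
    by rewrite /r_tilde -[lshift _ v]/(unsplit (inl v)) unsplitK addrC.
  by rewrite colKl; apply/colP=> i; rewrite !mxE eqxx andbT addr0.
have edge (j k : 'I_d) : (j < k)%N -> exists c : 'I_(d + #|upair d|),
    r_tilde R c = 2^-1 *: ('X_j + 'X_k) /\ col c (X12 d) = evec j + evec k.
  move=> jk; pose jk' : upair d := Sub (j, k) jk.
  exists (rshift _ (enum_rank jk')); split.
    by rewrite /r_tilde -[rshift _ _]/(unsplit (inr _)) unsplitK enum_rankK.
  by rewrite colKr; apply/colP=> i; rewrite mxE mxE enum_rankK.
have [vw|wv'|/val_inj E] := ltngtP v w; first exact: edge.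
  by rewrite /= addrC [evec v + _]addrC; apply: edge.
by rewrite E eqxx in wv.
Qed.

(** An integer matrix with an integer right inverse has determinant 1 or -1, and it
    has no repeated columns because the right inverse is also a left inverse. *)
Lemma unimodular_right_inverse (d : nat) (t : 'I_d -> 'I_(d + #|upair d|)) B :
  colsub t (X12 d) *m B = 1%:M -> unimodular t.
Proof.
set M := colsub t _ => MB; split.
  move=> a b tab; apply/eqP.
  have /matrixP BM := mulmx1C MB.
  have : (1%:M : 'M[int]_d) a a = 1%:M a b.
    by rewrite -!BM !mxE; apply: eq_bigr => i _; rewrite !mxE tab.
  by rewrite !mxE eqxx; case: eqP.
have /(congr1 determinant) := MB; rewrite det_mulmx det1 mulrC.
by move=> /intUnitRing.unitzPl; rewrite qualifE /= => /orP[] /eqP; [left|right].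
Qed.

(** Column [v] of the submatrix is the edge from [v] to its parent. The unit vectors
    are obtained from the columns by induction on the height, which gives a right
    inverse without sorting the vertices or computing a determinant. *)
Lemma tree_on_unimodular (R : realType) (d : nat) (f : 'I_d -> option 'I_d) :
  tree_on setT f ->
  exists t, unimodular t /\ tree_poly R setT f = 2 ^+ d *: q_tilde R t.
Proof.
move=> [h hP].
have /fin_all_exists[t tP] : forall v, exists c : 'I_(d + #|upair d|),
    r_tilde R c = 2^-1 *: ('X_v + vertex_coord R (f v)) /\
    col c (X12 d) = evec v + oapp (@evec d) 0 (f v).
  move=> v; apply: edge_column; apply/eqP=> fv.
  by have := hP v (in_setT v); rewrite fv ltnn andbF.
exists t; split; last first.
  rewrite /tree_poly /q_tilde big_mkcond /= (eq_bigr _ (fun i _ => (tP i).1)).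
  rewrite scaler_prod prodr_const card_ord exprVn scalerA mulfV ?scale1r.
    by apply: eq_bigr => i _; rewrite inE.
  by rewrite expf_neq0 // pnatr_eq0.
pose M := colsub t (X12 d).
have colM v : col v M = evec v + oapp (@evec d) 0 (f v).
  by rewrite -(tP v).2; apply/colP=> i; rewrite !mxE.
have inv v : exists x : 'cV[int]_d, M *m x = evec v.
  have [n] := ubnP (h v); elim: n v => // n IHn v; rewrite ltnS => hv.
  have vE : M *m evec v = evec v + oapp (@evec d) 0 (f v) by rewrite -colE.
  have := hP v (in_setT v); case: (f v) vE => [w|] /= vE.
    move=> /andP[_ hw]; have [x xE] := IHn w (leq_trans hw hv).
    by exists (evec v - x); rewrite mulmxBr vE xE addrK.
  by exists (evec v); rewrite vE addr0.
have [x xE] := fin_all_exists inv.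
apply: (@unimodular_right_inverse _ _ (\matrix_(i, v) x v i 0)).
apply/matrixP=> i v; have /colP/(_ i) := xE v; rewrite evecE !mxE => <-.
by apply: eq_bigr => k _; rewrite !mxE.
Qed.

(** * Vanishing on the punctured cube *)

(** A non-vanishing edge joins two vertices of equal sign, the vertex 0 having sign
    1; so it meets the set of the vertices of sign -1 in zero or two ends. *)
Lemma r_tilde_parity (R : realType) (d : nat) (eps : 'I_d -> R)
    (c : 'I_(d + #|upair d|)) :
  (forall i, eps i = -1 \/ eps i = 1) -> (r_tilde R c).@[eps] != 0 ->
  exists w : int, \sum_i (eps i == -1)%:R * X12 d i c = 2 * w.
Proof.
move=> eps1.
pose chi i : int := (eps i == -1)%R%:R.
have sumE k : \sum_i chi i * evec k i 0 = chi k.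
  rewrite (bigD1 k) //= evecE eqxx mulr1 big1 ?addr0 // => i ik.
  by rewrite evecE (negPf ik) mulr0.
rewrite -[c]splitK /r_tilde unsplitK; case: (split c) => [k|c'] /=.
  move=> nz; exists 0; rewrite mulr0.
  transitivity (chi k).
    by rewrite -sumE; apply: eq_bigr => i _; rewrite row_mxEl mxE.
  rewrite /chi; case: eqP => // ek; move: nz.
  by rewrite mevalZ mevalD meval1 mevalXU ek subrr mulr0 eqxx.
have -> : \sum_i chi i * X12 d i (rshift d c') =
   chi (val (enum_val c')).1 + chi (val (enum_val c')).2.
  rewrite -!sumE -big_split /=; apply: eq_bigr => i _.
  rewrite row_mxEr mxE; case: (enum_val c') => -[j k] jk /=.
  by rewrite mxE mulrDr.
case: (enum_val c') => -[j k] jk /=.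
rewrite mevalZ mevalD !mevalXU => nz; exists (chi j).
suff -> : chi k = chi j by rewrite mulr_natl mulr2n.
by rewrite /chi; case: (eps1 j) nz => ->; case: (eps1 k) => ->;
  rewrite ?subrr ?addNr ?mulr0 ?eqxx.
Qed.

Lemma q_tilde_cube_ideal (R : realType) (d : nat)
    (t : 'I_d -> 'I_(d + #|upair d|)) :
  unimodular t -> cube_ideal (q_tilde R t).
Proof.
move=> [_ detM] eps eps1 epsN1; apply/eqP; apply/negP => /negP nz.
apply: epsN1 => i; case: (eps1 i) => // ei; exfalso.
have /fin_all_exists[w wE] : forall k, exists w : int,
    \sum_i (eps i == -1)%:R * X12 d i (t k) = 2 * w.
  move=> k; apply: (r_tilde_parity eps1).
  apply: contraNneq nz => rk.
  by rewrite /q_tilde rmorph_prod (bigD1 k) //= rk mul0r.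
pose s : 'rV[int]_d := \row_i (eps i == -1)%:R.
pose M := colsub t (X12 d).
have sM : s *m M = 2 *: \row_k w k.
  apply/rowP=> k; rewrite !mxE -wE.
  by apply: eq_bigr => j _; rewrite !mxE.
(* Entry i of s * M * adj M is det M, and it is even: absurd. *)
have := congr1 (fun u => (u *m \adj M) 0 i) sM => /=.
rewrite -mulmxA mul_mx_adj mul_mx_scalar -scalemxAl !mxE ei eqxx mulr1.
set z := \sum_j _; move=> E.
by case: detM => dM; move: E; rewrite dM; lia.
Qed.

Theorem theorem2p11 (R : realType) (d : nat) (hd : (1 <= d)%N)
    (p : {mpoly R[d]}) :
  cube_ideal p <->
  ideal_generated
    (fun q : {mpoly R[d]} =>
       exists t : 'I_d -> 'I_(d + #|upair d|),
         unimodular t /\ q = q_tilde R t) p.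
Proof.
split=> [/cube_ideal_sub_tree_ideal p_tree | [n [a [g [gP ->]]]] eps e1 eN1].
  rewrite -[p]mulr1; apply: ideal_generated_mulr_sub p_tree => _ [f [fT ->]].
  have [t [tU ->]] := tree_on_unimodular R fT.
  rewrite mulr1 -mul_mpolyC; apply/ideal_generatedM/ideal_generated_gen.
  by exists t.
rewrite rmorph_sum big1 // => i _; have [t [tU ->]] := gP i.
by rewrite rmorphM /= (q_tilde_cube_ideal tU e1 eN1) mulr0.
Qed.
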